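(* Let $n\in\mathbb N$ and let $H_S\in\mathbb C^{n\times n}$ be Hermitian with degenerate Bohr spectrum, i.e. $\operatorname{ad}_{H_S}=[H_S,\cdot\,]$ has fewer than $n^2-n+1$ different eigenvalues. Then for every $T\in(0,\infty]$ the map $$\mathsf{TO}_n:\ (H,T')\mapsto\overline{\mathsf{TO}(H,T')}$$ from $\{H\in\mathbb C^{n\times n}: H\text{ Hermitian}\}\times(0,\infty]$ to the set of non-empty compact subsets of $\mathcal L(\mathbb C^{n\times n})$ equipped with the Hausdorff metric $\delta$ is discontinuous at $(H_S,T)$.
   Context: $\mathcal L(\mathbb C^{n\times n})$ is the space of linear maps on $\mathbb C^{n\times n}$, with norm $\|\cdot\|_{1\to1}$, the operator norm when domain and range carry the trace norm $\|A\|_1=\operatorname{tr}\sqrt{A^*A}$. For non-empty compact $A,B\subset\mathcal L(\mathbb C^{n\times n})$ the Hausdorff metric is $$\delta(A,B)=\max\{\max_{S_1\in A}\min_{S_2\in B}\|S_1-S_2\|_{1\to1},\ \max_{S_2\in B}\min_{S_1\in A}\|S_1-S_2\|_{1\to1}\}.$$ Hermitian matrices carry the usual topology and $(0,\infty]$ the topology of the metric $|\frac1T-\frac1{T'}|$ (with $\frac1\infty=0$). For $m\in\mathbb N$, $H_B\in\mathbb C^{m\times m}$ Hermitian, $U\in\mathbb C^{mn\times mn}$ unitary and $T\in(0,\infty)$ define $$\Phi_{T,m}(H_B,U)(X):=\operatorname{tr}_B\Big(U\Big(X\otimes\frac{e^{-H_B/T}}{\operatorname{tr}(e^{-H_B/T})}\Big)U^*\Big),$$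 where $\operatorname{tr}_B$ is the partial trace over the second tensor factor of $\mathbb C^n\otimes\mathbb C^m$; for $T=\infty$ the Gibbs state is replaced by $\frac1m\mathbb 1_m$. The set of thermal operations $\mathsf{TO}(H,T)$ consists of all $\Phi_{T,m}(H_B,U)$ with $m\in\mathbb N$, $H_B\in\mathbb C^{m\times m}$ Hermitian, and $U$ unitary satisfying $U(H\otimes\mathbb 1_m+\mathbb 1_n\otimes H_B)U^*=H\otimes\mathbb 1_m+\mathbb 1_n\otimes H_B$ (also imposed when $T=\infty$). The bar denotes closure; $\overline{\mathsf{TO}(H,T)}$ is compact. *)

(* Defs.v *)
From HB Require Import structures.
From mathcomp Require Import all_boot all_order all_algebra.
From mathcomp Require Import finmap complex mxtens.
From mathcomp Require Import all_classical all_reals all_analysis.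

Set Implicit Arguments.
Unset Strict Implicit.
Unset Printing Implicit Defensive.

Import Order.TTheory GRing.Theory Num.Theory.
Import numFieldNormedType.Exports.

Local Open Scope classical_set_scope.
Local Open Scope sesquilinear_scope.
Local Open Scope ring_scope.

(* The complex numbers over R, repackaged as a numClosedFieldType: the norm
   topology (and the entrywise one on matrices) is canonical on the carrier of a
   numClosedFieldType, but not on R[i] itself. *)
Definition Cplx (R : realType) : numClosedFieldType := R[i].

Section Norms.
Context {R : realType}.
Local Notation C := (Cplx R).

(* The positive square root of a positive semidefinite A, by functional calculus
   on the unitary diagonalization A = P^-1 *m diag_mx d *m P. *)
Definition sqrtmx n (A : 'M[C]_n) : 'M[C]_n :=
  invmx (spectralmx A) *m diag_mx (map_mx sqrtC (spectral_diag A))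
    *m spectralmx A.

Definition trnorm n (A : 'M[C]_n) : R := complex.Re (\tr (sqrtmx (A^t* *m A))).

Definition opnorm11 n (S : 'End('M[C]_n)) : R :=
  sup [set trnorm (S X) | X in [set X : 'M[C]_n | trnorm X <= 1]].

Definition closure11 n (A : set 'End('M[C]_n)) : set 'End('M[C]_n) :=
  [set S | forall e : R, 0 < e -> exists2 S', A S' & opnorm11 (S - S') < e].

(* Suprema and infima in \bar R make this meaningful for arbitrary sets; on
   non-empty compact sets they are finite and attained. *)
Definition hausdorff11 n (A B : set 'End('M[C]_n)) : \bar R :=
  maxe
    (ereal_sup [set ereal_inf [set (opnorm11 (S1 - S2))%:E | S2 in B] | S1 in A])
    (ereal_sup [set ereal_inf [set (opnorm11 (S1 - S2))%:E | S1 in A] | S2 in B]).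

End Norms.

Section BohrSpectrum.
Context {R : realType} {n : nat}.
Local Notation C := (Cplx R).

Definition ad_fun (H X : 'M[C]_n) : 'M[C]_n := H *m X - X *m H.

Fact ad_fun_is_linear (H : 'M[C]_n) : linear (ad_fun H).
Proof.
move=> a X Y; rewrite /ad_fun mulmxDr mulmxDl -scalemxAr -scalemxAl scalerBr.
by rewrite opprD addrACA.
Qed.

HB.instance Definition _ H :=
  GRing.isLinear.Build C 'M[C]_n 'M[C]_n *:%R (ad_fun H) (ad_fun_is_linear H).

Definition bohr_spectrum (H : 'M[C]_n) : set C :=
  [set a | passmx.leigenvalue (linfun (ad_fun H)) a].

(* fset_set sends infinite sets to fset0, but the spectrum is always finite. *)
Definition degenerate_bohr (H : 'M[C]_n) : bool :=
  (#|` fset_set (bohr_spectrum H)|%fset < n ^ 2 - n + 1)%N.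

End BohrSpectrum.

Section ParameterSpaces.
Variables (R : realType) (n : nat).

Definition hermitian_space : Type := initial_topology
  (fun H : {H : 'M[Cplx R]_n | H \is hermsymmx} => sval H).
HB.instance Definition _ := Topological.on hermitian_space.

(* The topology of the metric `|T^-1 - T'^-1| on ]0, +oo]; inverses are taken
   in \bar R, where +oo^-1 = 0. *)
Definition temperature : Type := initial_topology
  (fun T : {T : \bar R | (0 < T)%E} => fine (sval T)^-1%E).
HB.instance Definition _ := Topological.on temperature.

End ParameterSpaces.

Section ThermalOperations.
Context {R : realType}.
Local Notation C := (Cplx R).

Definition expmx m (A : 'M[C]_m) : 'M[C]_m :=
  limn (series (fun k => (k`!%:R)^-1 *: A ^+ k)).

Definition gibbs m (HB : 'M[C]_m) (T : temperature R) : 'M[C]_m :=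
  if sval T is t%:E then
    let E := expmx (- (t^-1)%:C%C *: HB) in (\tr E)^-1 *: E
  else (m%:R)^-1 *: 1%:M.

Definition ptrace_B n m (Y : 'M[C]_(n * m)) : 'M[C]_n :=
  \matrix_(i, j) \sum_(k < m) Y (mxtens_index (i, k)) (mxtens_index (j, k)).

Definition thermal_fun n m (T : temperature R) (HB : 'M[C]_m)
    (U : 'M[C]_(n * m)) (X : 'M[C]_n) : 'M[C]_n :=
  ptrace_B (U *m (X *t gibbs HB T) *m U^t*).

Fact thermal_fun_is_linear n m T (HB : 'M[C]_m) (U : 'M[C]_(n * m)) :
  linear (thermal_fun T HB U).
Proof.
move=> a X Y; rewrite /thermal_fun.
have -> : (a *: X + Y) *t gibbs HB T
    = a *: (X *t gibbs HB T) + Y *t gibbs HB T.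
  by apply/matrixP=> i j; rewrite !mxE mulrDl mulrA.
rewrite mulmxDr mulmxDl -scalemxAr -scalemxAl; apply/matrixP=> i j.
rewrite !mxE mulr_sumr -big_split; apply: eq_bigr => k _.
by rewrite [LHS]mxE [X in X + _]mxE.
Qed.

HB.instance Definition _ n m T (HB : 'M[C]_m) (U : 'M[C]_(n * m)) :=
  GRing.isLinear.Build C 'M[C]_n 'M[C]_n *:%R (thermal_fun T HB U)
    (thermal_fun_is_linear T HB U).

Definition thermal_map n m (T : temperature R) (HB : 'M[C]_m)
  (U : 'M[C]_(n * m)) : 'End('M[C]_n) := linfun (thermal_fun T HB U).

Definition total_hamiltonian n m (H : 'M[C]_n) (HB : 'M[C]_m) :
  'M[C]_(n * m) := H *t 1%:M + 1%:M *t HB.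

Definition TO n (H : 'M[C]_n) (T : temperature R) : set 'End('M[C]_n) :=
  [set S | exists (m : nat) (HB : 'M[C]_m) (U : 'M[C]_(n * m)),
    [/\ (0 < m)%N, HB \is hermsymmx, U \is unitarymx,
        U *m total_hamiltonian H HB *m U^t* = total_hamiltonian H HB
      & S = thermal_map T HB U]].

Definition TO_closure n (HT : hermitian_space R n * temperature R) :
  set 'End('M[C]_n) := closure11 (TO (sval HT.1) HT.2).

End ThermalOperations.

(* Main.v *)
(** The eigenbasis coefficients of a thermal operation are what jumps.  Write
    H_S = W diag(v) W^*.  Degeneracy of the Bohr spectrum yields i != j, k != l,
    i != k with v_i - v_j = v_k - v_l.  With a qubit bath of Hamiltonian
    diag(0, v_i - v_k), the permutation exchanging (i,0) with (k,1) and (j,0)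
    with (l,1) conserves energy, so it gives a thermal operation Phi of H_S whose
    transition coefficient <k| Phi(|i><j|) |l> is at least the ground-state
    population of the bath.  Every thermal operation of H commutes with ad_H;
    for H = H_S + x |i><i| with x != 0 the two differences v_i - v_j and
    v_k - v_l become distinct, so this coefficient vanishes on all of TO(H, T).
    As the coefficient is bounded by n times the norm, TO(H, T) keeps a fixed
    distance to Phi as x tends to 0, already at the constant temperature T. *)
Require Import Defs.
From HB Require Import structures.
From mathcomp Require Import all_boot all_order all_algebra.
From mathcomp Require Import finmap complex mxtens.
From mathcomp Require Import all_classical all_reals all_analysis.
From mathcomp Require Import perm ring lra.

Set Implicit Arguments.
Unset Strict Implicit.
Unset Printing Implicit Defensive.

Import Order.TTheory GRing.Theory Num.Theory.
Import numFieldNormedType.Exports.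

Local Open Scope classical_set_scope.
Local Open Scope ring_scope.
Local Open Scope sesquilinear_scope.

(** * Matrices *)

Lemma exprmx_conj (F : fieldType) m (P A : 'M[F]_m) k : P \in unitmx ->
  (invmx P *m A *m P) ^+ k = invmx P *m A ^+ k *m P.
Proof.
move=> uP; elim: k => [|k IH]; first by rewrite !expr0 mulmx1 mulVmx.
by rewrite !exprS IH -!mulmxE !mulmxA mulmxK.
Qed.

Lemma exprmx_diag (F : fieldType) m (v : 'rV[F]_m) k :
  diag_mx v ^+ k = diag_mx (map_mx (fun x => x ^+ k) v).
Proof.
elim: k => [|k IH].
  by apply/matrixP => i j; rewrite !mxE expr0.
rewrite exprS IH -mulmxE mulmx_diag; congr diag_mx.
by apply/rowP => i; rewrite !mxE exprS.
Qed.

Lemma conj_diag_comm (F : fieldType) m (P : 'M[F]_m) (d1 d2 : 'rV[F]_m) : P \in unitmx ->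
  (invmx P *m diag_mx d1 *m P) *m (invmx P *m diag_mx d2 *m P) =
  (invmx P *m diag_mx d2 *m P) *m (invmx P *m diag_mx d1 *m P).
Proof.
move=> uP; rewrite !mulmxA !mulmxK // -!(mulmxA (invmx P)) !mulmx_diag.
by congr (_ *m (diag_mx _ *m _)); apply/rowP => i; rewrite !mxE mulrC.
Qed.

Lemma scale_conjmx (F : fieldType) m (P A : 'M[F]_m) a :
  a *: (invmx P *m A *m P) = invmx P *m (a *: A) *m P.
Proof. by rewrite scalemxAl scalemxAr. Qed.

(** * Entries of products with factors [A *t 1%:M] and [1%:M *t K] *)

Lemma sum_mxtens (F : comPzRingType) n m (f : 'I_(n * m) -> F) :
  \sum_x f x = \sum_i \sum_a f (mxtens_index (i, a)).
Proof.
rewrite (reindex (@mxtens_index n m)) /=; last first.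
  by exists (@mxtens_unindex n m) => ? _; rewrite ?mxtens_indexK ?mxtens_unindexK.
by rewrite pair_bigA /=; apply: eq_bigr => -[].
Qed.

Lemma mul_tens1mxE (F : comPzRingType) n m (A : 'M[F]_n) (Y : 'M[F]_(n * m)) i a y :
  ((A *t 1%:M) *m Y) (mxtens_index (i, a)) y =
  \sum_j A i j * Y (mxtens_index (j, a)) y.
Proof.
rewrite mxE sum_mxtens.
apply: eq_bigr => j _; rewrite (bigD1 a) //= big1 ?addr0 => [|b ba].
  by rewrite tensmxE mxE eqxx mulr1.
by rewrite tensmxE mxE eq_sym (negPf ba) mulr0 mul0r.
Qed.

Lemma mul_mxtens1E (F : comPzRingType) n m (A : 'M[F]_n) (Y : 'M[F]_(n * m)) i a y :
  (Y *m (A *t 1%:M)) y (mxtens_index (i, a)) =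
  \sum_j Y y (mxtens_index (j, a)) * A j i.
Proof.
rewrite -[LHS](mxE trmx_key (fun i j => (Y *m (A *t 1%:M)) j i)).
rewrite -/((Y *m (A *t 1%:M))^T) trmx_mul trmx_tens trmx1.
by rewrite mul_tens1mxE; apply: eq_bigr => j _; rewrite !mxE mulrC.
Qed.

Lemma mul_1tensmxE (F : comPzRingType) n m (K : 'M[F]_m) (Y : 'M[F]_(n * m)) i a y :
  ((1%:M *t K) *m Y) (mxtens_index (i, a)) y =
  \sum_b K a b * Y (mxtens_index (i, b)) y.
Proof.
rewrite mxE sum_mxtens.
rewrite (bigD1 i) //= [X in _ + X]big1 ?addr0 => [|j ji].
  by apply: eq_bigr => b _; rewrite tensmxE mxE eqxx mul1r.
by rewrite big1 // => b _; rewrite tensmxE mxE eq_sym (negPf ji) !mul0r.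
Qed.

Lemma mul_mx1tensE (F : comPzRingType) n m (K : 'M[F]_m) (Y : 'M[F]_(n * m)) i a y :
  (Y *m (1%:M *t K)) y (mxtens_index (i, a)) =
  \sum_b Y y (mxtens_index (i, b)) * K b a.
Proof.
rewrite -[LHS](mxE trmx_key (fun i j => (Y *m (1%:M *t K)) j i)).
rewrite -/((Y *m (1%:M *t K))^T) trmx_mul trmx_tens trmx1.
by rewrite mul_1tensmxE; apply: eq_bigr => j _; rewrite !mxE mulrC.
Qed.

Lemma tensmxBl (F : pzRingType) m n p q (A A' : 'M[F]_(m, n)) (B : 'M[F]_(p, q)) :
  (A - A') *t B = A *t B - A' *t B.
Proof. by apply/matrixP=> i j; rewrite !mxE mulrBl. Qed.

(** * Conjugation by unitary, permutation and tensor product matrices *)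

Lemma mul_ctmx (F : numClosedFieldType) m n p (A : 'M[F]_(m, n)) (B : 'M[F]_(n, p)) :
  (A *m B)^t* = B^t* *m A^t*.
Proof. by rewrite trmx_mul map_mxM. Qed.

Lemma unitary_ctmxK (F : numClosedFieldType) n (W : 'M[F]_n) :
  W \is unitarymx -> W^t* *m W = 1%:M.
Proof. by move=> uW; rewrite -(invmx_unitary uW) mulVmx // unitarymx_unit. Qed.

Lemma unitary_conjK (F : numClosedFieldType) n (W Y : 'M[F]_n) : W \is unitarymx ->
  W *m (W^t* *m Y *m W) *m W^t* = Y.
Proof.
move=> uW; rewrite !mulmxA (unitarymxP uW) mul1mx -mulmxA (unitarymxP uW).
by rewrite mulmx1.
Qed.

Lemma unitary_conjVK (F : numClosedFieldType) n (W Y : 'M[F]_n) : W \is unitarymx ->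
  W^t* *m (W *m Y *m W^t*) *m W = Y.
Proof.
move=> uW; rewrite !mulmxA unitary_ctmxK // mul1mx -mulmxA unitary_ctmxK //.
by rewrite mulmx1.
Qed.

Lemma unitary_conj_unitary (F : numClosedFieldType) m (V A : 'M[F]_m) :
  V \is unitarymx -> A \is unitarymx -> V *m A *m V^t* \is unitarymx.
Proof. by move=> uV uA; rewrite !mul_unitarymx ?trmxC_unitary. Qed.

Lemma unitary_conj_conj (F : numClosedFieldType) m (V A Y : 'M[F]_m) :
  V \is unitarymx ->
  (V *m A *m V^t*) *m (V *m Y *m V^t*) *m (V *m A *m V^t*)^t* =
  V *m (A *m Y *m A^t*) *m V^t*.
Proof.
move=> uV; rewrite !trmx_mul !map_mxM trmxCK !mulmxA.
by rewrite -!(mulmxA _ (V^t*) V) !unitary_ctmxK // !mulmx1.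
Qed.

Lemma perm_mx_conjE (F : numClosedFieldType) m (s : 'S_m) (M : 'M[F]_m) x y :
  (perm_mx s *m M *m (perm_mx s)^t*) x y = M (s x) (s y).
Proof.
by rewrite tr_perm_mx map_perm_mx -row_permE -col_permE !mxE.
Qed.

Lemma perm_mx_unitary (F : numClosedFieldType) m (s : 'S_m) :
  (perm_mx s : 'M[F]_m) \is unitarymx.
Proof.
by apply/unitarymxP; rewrite tr_perm_mx map_perm_mx -perm_mxM mulgV perm_mx1.
Qed.

Lemma tens_ctmx (F : numClosedFieldType) m n p q (A : 'M[F]_(m, n)) (B : 'M[F]_(p, q)) :
  (A *t B)^t* = A^t* *t B^t*.
Proof. by rewrite trmx_tens map_mxT. Qed.

Lemma tens_unitary (F : numClosedFieldType) m n (A : 'M[F]_m) (B : 'M[F]_n) :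
  A \is unitarymx -> B \is unitarymx -> A *t B \is unitarymx.
Proof.
move=> /unitarymxP uA /unitarymxP uB; apply/unitarymxP.
rewrite tens_ctmx tensmx_mul uA uB; apply/matrixP => x y.
case: (mxtens_indexP x) => i a; case: (mxtens_indexP y) => j b.
by rewrite tensmxE !mxE (can_eq (@mxtens_indexK _ _)) xpair_eqE -natrM mulnb.
Qed.

(** * The matrix exponential of a Hermitian matrix *)

Lemma mx_cvg (K : numFieldType) (T : Type) (F : set_system T) (FF : Filter F)
    m n (f : T -> 'M[K]_(m, n)) (L : 'M[K]_(m, n)) :
  (forall i j, f t i j @[t --> F] --> L i j) -> f @ F --> L.
Proof.
move=> fL P [Q QL QP]; apply: (@filterS _ F FF (fun t => forall i j, Q i j (f t i j))).
  by move=> t /= Qt; apply: QP.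
by apply: filter_forall => i; apply: filter_forall => j; apply: fL; apply: QL.
Qed.

Lemma cvg_sumr (K : numFieldType) (V : normedModType K) (T I : Type)
    (F : set_system T) (FF : Filter F) (r : seq I) (P : pred I)
    (f : I -> T -> V) (a : I -> V) :
  (forall i, P i -> f i @ F --> a i) ->
  \sum_(i <- r | P i) f i t @[t --> F] --> \sum_(i <- r | P i) a i.
Proof. by apply: cvg_big; exact: add_continuous. Qed.

Section RealToComplex.
Context {R : realType}.
Local Notation C := (Cplx R).

(* Typing the codomain as [Cplx R] instead of R[i] matters: otherwise unification
   has to unfold the structures of one into those of the other. *)
Definition toC (x : R) : C := x%:C%C.

Fact toC_is_zmod_morphism : zmod_morphism toC.
Proof. by move=> x y; exact: (rmorphB (real_complex R)). Qed.

Fact toC_is_monoid_morphism : monoid_morphism toC.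
Proof.
split => [|x y]; first exact: (rmorph1 (real_complex R)).
exact: (rmorphM (real_complex R)).
Qed.

HB.instance Definition _ := GRing.isZmodMorphism.Build R C toC toC_is_zmod_morphism.
HB.instance Definition _ := GRing.isMonoidMorphism.Build R C toC toC_is_monoid_morphism.

Lemma le_toC x y : (toC x <= toC y) = (x <= y). Proof. exact: lecR. Qed.
Lemma lt_toC x y : (toC x < toC y) = (x < y). Proof. exact: ltcR. Qed.

Lemma norm_toC (x : R) : `|toC x| = toC `|x|.
Proof. by rewrite /toC normc_def /= expr0n addr0 sqrtr_sqr. Qed.

Lemma toC_Re (x : C) : x \is Num.real -> toC (complex.Re x) = x.
Proof. exact: RRe_real. Qed.

Lemma real_toC (x : R) : toC x \is Num.real.
Proof. by rewrite /toC complex_real. Qed.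

Lemma continuous_toC : continuous toC.
Proof.
move=> x; apply/cvgrPdist_lt => e e0.
have eE : toC (complex.Re e) = e by apply/toC_Re/gtr0_real.
have e1 : 0 < complex.Re e by rewrite -lt_toC eE rmorph0.
near=> y.
rewrite -rmorphB norm_toC -eE lt_toC.
by near: y; apply: cvgr_dist_lt.
Unshelve. all: by end_near. Qed.

(** Conjugation commutes with the partial sums, so the series reduces to the real exponential series
    on each diagonal entry, and the limit is taken entrywise. *)
Lemma expmx_diagonalizable m (P : 'M[C]_m) (v : 'rV[R]_m) : P \in unitmx ->
  expmx (invmx P *m diag_mx (map_mx toC v) *m P) =
  invmx P *m diag_mx (map_mx (toC \o expR) v) *m P.
Proof.
move=> uP; rewrite /expmx.
pose s k := \row_i (toC (series (exp_coeff (v 0 i)) k)).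
have sE : series (fun k => (k`!%:R)^-1 *:
    (invmx P *m diag_mx (map_mx toC v) *m P) ^+ k) =
    (fun k => invmx P *m diag_mx (s k) *m P).
  apply/funext => k; rewrite /series /=.
  under eq_bigr do rewrite exprmx_conj // exprmx_diag scale_conjmx.
  rewrite -mulmx_suml -mulmx_sumr; congr (_ *m _ *m _).
  apply/matrixP => i j; rewrite summxE !mxE.
  rewrite /series /= rmorph_sum -sumrMnl; apply: eq_bigr => l _.
  rewrite !mxE mulrnAr; congr (_ *+ _).
  by rewrite /exp_coeff /= rmorphM rmorphXn fmorphV rmorph_nat mulrC.
rewrite sE; apply: cvg_lim; first exact: norm_hausdorff.
apply: mx_cvg => i j.
under eq_fun do rewrite mxE.
rewrite mxE.
apply: cvg_sumr => l _; apply: cvgM; last exact: cvg_cst.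
under eq_fun do rewrite mxE.
rewrite mxE; apply: cvg_sumr => q _; apply: cvgM; first exact: cvg_cst.
under eq_fun do rewrite !mxE.
rewrite !mxE; apply: cvgMn.
have c : series (exp_coeff (v 0 q)) @ \oo --> expR (v 0 q).
  exact: is_cvg_series_exp_coeff.
exact: (cvg_comp _ _ c (@continuous_toC _)).
Qed.

End RealToComplex.

(** * Trace norm *)

Section TraceNorm.
Context {R : realType}.
Local Notation C := (Cplx R).

(** The squared Frobenius norm. It is entrywise and unitarily invariant, and it mediates between
    single matrix entries and the trace norm. *)
Definition frobsq m n (A : 'M[C]_(m, n)) : C := \sum_j \sum_i `|A i j| ^+ 2.

Lemma frobsqE m n (A : 'M[C]_(m, n)) : frobsq A = \tr (A^t* *m A).
Proof.
rewrite /frobsq; apply: eq_bigr => j _; rewrite mxE; apply: eq_bigr => i _.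
by rewrite !mxE normCK mulrC.
Qed.

Lemma frobsq_ge0 m n (A : 'M[C]_(m, n)) : 0 <= frobsq A.
Proof. by apply: sumr_ge0 => i _; apply: sumr_ge0 => j _; rewrite exprn_ge0. Qed.

Lemma normsq_le_frobsq m n (A : 'M[C]_(m, n)) i j : `|A i j| ^+ 2 <= frobsq A.
Proof.
rewrite /frobsq (bigD1 j) //= (bigD1 i) //= -addrA lerDl addr_ge0 //.
  by apply: sumr_ge0 => i' _; rewrite exprn_ge0.
by apply: sumr_ge0 => j' _; apply: sumr_ge0 => i' _; rewrite exprn_ge0.
Qed.

Lemma frobsq_mulr_unitary m n (A : 'M[C]_(m, n)) (W : 'M[C]_n) :
  W \is unitarymx -> frobsq (A *m W) = frobsq A.
Proof.
move=> uW; rewrite !frobsqE mul_ctmx mxtrace_mulC mulmxA.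
by rewrite mulmxtVK // mxtrace_mulC.
Qed.

Lemma frobsq_mull_unitary m n (A : 'M[C]_(m, n)) (W : 'M[C]_m) :
  W \is unitarymx -> frobsq (W *m A) = frobsq A.
Proof.
by move=> uW; rewrite !frobsqE mul_ctmx -mulmxA (mulmxA _ W) -(invmx_unitary uW)
  mulVmx ?mul1mx // unitarymx_unit.
Qed.

(** With [P] diagonalizing the Gram matrix, its [i]-th eigenvalue is the squared length of the
    [i]-th column of [A *m P^t*]. *)
Lemma spectral_diag_gram_ge0 m n (A : 'M[C]_(m, n)) i :
  0 <= spectral_diag (A^t* *m A) 0 i.
Proof.
set B := A^t* *m A; pose P := spectralmx B.
have uP : P \is unitarymx by apply: spectral_unitarymx.
have hB : B \is hermsymmx.
  by apply/is_hermitianmxP; rewrite scale1r /B mul_ctmx trmxCK.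
have /orthomx_spectralP BE := hermitian_normalmx hB.
have -> : spectral_diag B 0 i = ((A *m P^t*)^t* *m (A *m P^t*)) i i.
  rewrite mul_ctmx trmxCK !mulmxA -(mulmxA P) -/B [X in P *m X]BE -/P.
  rewrite -(invmx_unitary uP) !mulmxA mulmxV ?unitarymx_unit // mul1mx.
  by rewrite mulmxK ?unitarymx_unit // mxE eqxx mulr1n.
rewrite mxE; apply: sumr_ge0 => j _; rewrite !mxE.
by rewrite mulrC -normCK exprn_ge0.
Qed.

Lemma sum_spectral_diag_gram m n (A : 'M[C]_(m, n)) :
  \sum_i spectral_diag (A^t* *m A) 0 i = frobsq A.
Proof.
set B := A^t* *m A; pose P := spectralmx B.
have hB : B \is hermsymmx.
  by apply/is_hermitianmxP; rewrite scale1r /B mul_ctmx trmxCK.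
have /orthomx_spectralP BE := hermitian_normalmx hB.
rewrite frobsqE -/B [in RHS]BE mxtrace_mulC mulmxA mulmxV ?spectral_unit // mul1mx.
by rewrite mxtrace_diag.
Qed.

(** The summands are the singular values, which are nonnegative, so the real part taken in [trnorm]
    discards nothing. *)
Lemma trnormE n (A : 'M[C]_n) :
  (trnorm A)%:C%C = \sum_i sqrtC (spectral_diag (A^t* *m A) 0 i) :> C.
Proof.
rewrite /trnorm /sqrtmx mxtrace_mulC mulmxA mulmxV ?spectral_unit // mul1mx.
rewrite mxtrace_diag; under eq_bigr do rewrite mxE.
apply: RRe_real; apply: ger0_real; apply: sumr_ge0 => i _.
by rewrite sqrtC_ge0 spectral_diag_gram_ge0.
Qed.

Lemma trnorm_ge0 n (A : 'M[C]_n) : 0 <= trnorm A.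
Proof.
rewrite -lecR trnormE; apply: sumr_ge0 => i _.
by rewrite sqrtC_ge0 spectral_diag_gram_ge0.
Qed.

(** For nonnegative singular values, the sum of the squares is at most the square of the sum. *)
Lemma frobsq_le_trnorm n (A : 'M[C]_n) : frobsq A <= (trnorm A ^+ 2)%:C%C.
Proof.
rewrite rmorphXn /= trnormE -sum_spectral_diag_gram expr2 mulr_suml.
apply: ler_sum => i _.
have d0 k : 0 <= sqrtC (spectral_diag (A^t* *m A) 0 k).
  by rewrite sqrtC_ge0 spectral_diag_gram_ge0.
rewrite -[leLHS]sqrtCK expr2 ler_wpM2l // (bigD1 i) //= lerDl.
by apply: sumr_ge0.
Qed.

(** Each of the [n] singular values is at most the Frobenius norm; this crude constant is enough. *)
Lemma trnorm_le_frob n (A : 'M[C]_n) :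
  (trnorm A)%:C%C <= n%:R * sqrtC (frobsq A).
Proof.
have -> : n%:R * sqrtC (frobsq A) = \sum_(i < n) sqrtC (frobsq A).
  by rewrite sumr_const card_ord mulr_natl.
rewrite trnormE.
apply: ler_sum => i _.
rewrite ler_sqrtC ?qualifE/= ?spectral_diag_gram_ge0 ?frobsq_ge0 //.
rewrite -sum_spectral_diag_gram (bigD1 i) //= lerDl.
by apply: sumr_ge0 => j _; apply: spectral_diag_gram_ge0.
Qed.

(** Without this bound [sup] could return its default value 0, and [opnorm11] would control
    nothing. *)
Lemma trnorm_image_bounded n (S : 'End('M[C]_n)) :
  has_ubound [set trnorm (S X) | X in [set X : 'M[C]_n | trnorm X <= 1]].
Proof.
(* On the trace norm unit ball all entries of [X] have modulus at most 1, so expanding [X] in matrix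
   units makes [K] a bound for [frobsq (S X)]. *)
pose K : C := \sum_k \sum_l (\sum_i \sum_j `|S (delta_mx i j) l k|) ^+ 2.
have K0 : 0 <= K.
  apply: sumr_ge0 => k _; apply: sumr_ge0 => l _; rewrite exprn_ge0 //.
  by apply: sumr_ge0 => i _; apply: sumr_ge0.
exists (complex.Re (n%:R * sqrtC K)) => _ [X X1 <-].
rewrite -lecR RRe_real; last by rewrite ger0_real // mulr_ge0 // sqrtC_ge0.
apply: le_trans (trnorm_le_frob _) _; rewrite ler_wpM2l //.
rewrite ler_sqrtC ?qualifE/= ?frobsq_ge0 //.
apply: ler_sum => k _; apply: ler_sum => l _.
rewrite lerXn2r ?qualifE/= ?normr_ge0 //.
  by apply: sumr_ge0 => i _; apply: sumr_ge0.
rewrite {1}(matrix_sum_delta X) linear_sum summxE.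
apply: le_trans (ler_norm_sum _ _ _) _; apply: ler_sum => i _.
rewrite linear_sum summxE.
apply: le_trans (ler_norm_sum _ _ _) _; apply: ler_sum => j _.
rewrite linearZ mxE normrM ler_piMl //.
rewrite -(@expr_le1 _ 2) //.
apply: le_trans (normsq_le_frobsq _ _ _) _; apply: le_trans (frobsq_le_trnorm _) _.
by rewrite lecR -(expr1n _ 2) lerXn2r ?qualifE/= ?trnorm_ge0.
Qed.

Lemma trnorm_le_opnorm11 n (S : 'End('M[C]_n)) X :
  trnorm X <= 1 -> trnorm (S X) <= opnorm11 S.
Proof.
by move=> X1; apply: ub_le_sup; [exact: trnorm_image_bounded|exists X].
Qed.

(** The rotated matrix unit has Frobenius norm 1, hence trace norm at most [n]; dividing by [n] puts
    it into the unit ball, which is where the factor [n] comes from. An entry of the image is then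
    bounded by its Frobenius norm, and that by its trace norm. *)
Lemma coef_le_opnorm11 n (S : 'End('M[C]_n)) (W : 'M[C]_n) i j k l :
  W \is unitarymx ->
  `|(W^t* *m S (W *m delta_mx i j *m W^t*) *m W) k l| <= (n%:R * opnorm11 S)%:C%C.
Proof.
move=> uW; set X := W *m _ *m _.
have n0 : (0 < n)%N by case: n i {j k l S W uW X} => [[]|].
have uW' : W^t* \is unitarymx by rewrite trmxC_unitary.
have fX : frobsq X = 1.
  rewrite frobsq_mulr_unitary // frobsq_mull_unitary // /frobsq.
  rewrite (bigD1 j) //= (bigD1 i) //= mxE !eqxx normr1 expr1n.
  rewrite big1 ?big1 ?addr0 // => [j' nj|i' ni].
    by rewrite big1 // => i' _; rewrite mxE (negPf nj) andbF normr0 expr0n.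
  by rewrite mxE (negPf ni) normr0 expr0n.
have n0C : 0 < n%:R :> C by rewrite ltr0n.
have tX : trnorm (n%:R^-1 *: X) <= 1.
  rewrite -lecR; apply: le_trans (trnorm_le_frob _) _.
  have -> : frobsq (n%:R^-1 *: X) = n%:R^-1 ^+ 2.
    rewrite /frobsq; under eq_bigr => k' _ do
      under eq_bigr => l' _ do rewrite mxE normrM exprMn.
    under eq_bigr do rewrite -mulr_sumr.
    by rewrite -mulr_sumr -/(frobsq X) fX mulr1 ger0_norm // invr_ge0 ltW.
  by rewrite sqrCK ?invr_ge0 ?ler0n // divff ?lt0r_neq0.
have := trnorm_le_opnorm11 S tX.
set Y := S _ => Yle.
have o0 : 0 <= opnorm11 S by apply: le_trans Yle; apply: trnorm_ge0.
have -> : S X = n%:R *: Y by rewrite /Y linearZ scalerA divff ?scale1r ?lt0r_neq0.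
rewrite -scalemxAr -scalemxAl mxE normrM ger0_norm ?ler0n //.
rewrite rmorphM rmorph_nat ler_wpM2l //.
rewrite -(@ler_pXn2r _ 2) ?nnegrE ?normr_ge0 ?ler0c //.
apply: le_trans (normsq_le_frobsq _ _ _) _.
rewrite frobsq_mulr_unitary // frobsq_mull_unitary //.
apply: le_trans (frobsq_le_trnorm _) _.
by rewrite -rmorphXn lecR lerXn2r ?qualifE/= ?trnorm_ge0.
Qed.

End TraceNorm.

(** * Covariance of thermal operations *)

Section Thermal.
Context {R : realType}.
Local Notation C := (Cplx R).

Lemma ptrace_mull n m (A : 'M[C]_n) (Y : 'M[C]_(n * m)) :
  ptrace_B ((A *t 1%:M) *m Y) = A *m ptrace_B Y.
Proof.
apply/matrixP => i j; rewrite !mxE; under eq_bigr do rewrite mul_tens1mxE.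
by rewrite exchange_big; apply: eq_bigr => k _; rewrite mxE mulr_sumr.
Qed.

Lemma ptrace_mulr n m (A : 'M[C]_n) (Y : 'M[C]_(n * m)) :
  ptrace_B (Y *m (A *t 1%:M)) = ptrace_B Y *m A.
Proof.
apply/matrixP => i j; rewrite !mxE; under eq_bigr do rewrite mul_mxtens1E.
by rewrite exchange_big; apply: eq_bigr => k _; rewrite mxE mulr_suml.
Qed.

(** The partial trace is cyclic for operators acting on the bath alone; this removes the bath
    Hamiltonian from commutators. *)
Lemma ptrace_cycl n m (K : 'M[C]_m) (Y : 'M[C]_(n * m)) :
  ptrace_B ((1%:M *t K) *m Y) = ptrace_B (Y *m (1%:M *t K)).
Proof.
apply/matrixP => i j; rewrite !mxE.
under eq_bigr do rewrite mul_1tensmxE.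
under [RHS]eq_bigr do rewrite mul_mx1tensE.
rewrite exchange_big; apply: eq_bigr => k _; apply: eq_bigr => l _.
by rewrite mulrC.
Qed.

Lemma ptraceD n m (Y Z : 'M[C]_(n * m)) : ptrace_B (Y + Z) = ptrace_B Y + ptrace_B Z.
Proof.
by apply/matrixP => i j; rewrite !mxE -big_split; apply: eq_bigr => k _; rewrite mxE.
Qed.

Lemma ptraceB n m (Y Z : 'M[C]_(n * m)) : ptrace_B (Y - Z) = ptrace_B Y - ptrace_B Z.
Proof.
by apply/matrixP => i j; rewrite !mxE -sumrB; apply: eq_bigr => k _; rewrite !mxE.
Qed.

Lemma total_hamiltonian_gibbs n m (H X : 'M[C]_n) (K g : 'M[C]_m) :
  K *m g = g *m K ->
  total_hamiltonian H K *m (X *t g) - (X *t g) *m total_hamiltonian H K =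
  ad_fun H X *t g.
Proof.
move=> Kg; rewrite /total_hamiltonian mulmxDl mulmxDr !tensmx_mul.
rewrite !mulmx1 !mul1mx Kg /ad_fun tensmxBl.
by rewrite opprD addrACA subrr addr0.
Qed.

(** [ad_fun H X *t gibbs K T] is the commutator of the total Hamiltonian with [X *t gibbs K T].
    Conjugation by [U] respects this commutator, and tracing out the bath turns it into the
    commutator with [H]. *)
Lemma thermal_fun_covariant n m (T : temperature R) (H : 'M[C]_n) (K : 'M[C]_m)
    (U : 'M[C]_(n * m)) (X : 'M[C]_n) :
  K *m gibbs K T = gibbs K T *m K -> U \is unitarymx ->
  U *m total_hamiltonian H K *m U^t* = total_hamiltonian H K ->
  thermal_fun T K U (ad_fun H X) = ad_fun H (thermal_fun T K U X).
Proof.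
move=> Kg uU; set Ht := total_hamiltonian H K => UH.
have UHc : U *m Ht = Ht *m U.
  by rewrite -[in RHS]UH -(invmx_unitary uU) mulmxKV // unitarymx_unit.
have UHc' : Ht *m U^t* = U^t* *m Ht.
  by rewrite -[in RHS]UH !mulmxA -(invmx_unitary uU) mulVmx ?mul1mx // unitarymx_unit.
rewrite /thermal_fun /ad_fun.
set Z := U *m (X *t gibbs K T) *m U^t*.
rewrite -[in LHS]/(ad_fun H X).
(* The two terms containing [1%:M *t K] cancel by [ptrace_cycl]. *)
have -> : H *m ptrace_B Z - ptrace_B Z *m H = ptrace_B (Ht *m Z - Z *m Ht).
  rewrite /Ht /total_hamiltonian mulmxDl mulmxDr ptraceB !ptraceD ptrace_cycl.
  by rewrite ptrace_mull ptrace_mulr opprD addrACA subrr addr0.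
rewrite -(total_hamiltonian_gibbs _ _ Kg) -/Ht.
congr ptrace_B; rewrite /Z mulmxBr mulmxBl !mulmxA UHc -!mulmxA UHc'.
by [].
Qed.

End Thermal.

(** * Gibbs states in an eigenbasis of the bath Hamiltonian *)

Section Gibbs.
Context {R : realType}.
Local Notation C := (Cplx R).
Local Notation "v ^%:C" := (map_mx toC v) (at level 8).

Lemma hermitian_spectral m (K : 'M[C]_m) : K \is hermsymmx ->
  exists (P : 'M[C]_m) (v : 'rV[R]_m),
    P \is unitarymx /\ K = invmx P *m diag_mx v^%:C *m P.
Proof.
move=> hK; exists (spectralmx K), (map_mx (@complex.Re R) (spectral_diag K)).
split; first exact: spectral_unitarymx.
have /orthomx_spectralP {1}-> := hermitian_normalmx hK.
congr (_ *m diag_mx _ *m _); apply/rowP => i; rewrite !mxE toC_Re //.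
exact: (mxOverP (hermitian_spectral_diag_real hK)).
Qed.

(** The Gibbs state is a function of the Hamiltonian, hence diagonal in the same basis, with
    strictly positive populations at every temperature. *)
Lemma gibbs_conj_diag m (P : 'M[C]_m) (v : 'rV[R]_m) (T : temperature R) :
  (0 < m)%N -> P \in unitmx ->
  exists2 p : 'rV[R]_m, (forall i, 0 < p 0 i)
    & gibbs (invmx P *m diag_mx v^%:C *m P) T = invmx P *m diag_mx p^%:C *m P.
Proof.
move=> m0 uP; rewrite /gibbs.
(* The infinite values of [sval T] select the uniform state. *)
have inf : exists2 p : 'rV[R]_m, (forall i, 0 < p 0 i)
    & (m%:R)^-1 *: 1%:M = invmx P *m diag_mx p^%:C *m P.
  exists (const_mx m%:R^-1) => [i|]; first by rewrite mxE invr_gt0 ltr0n.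
  rewrite map_const_mx diag_const_mx mul_mx_scalar -scalemxAl mulVmx //.
  by rewrite fmorphV rmorph_nat.
case: (sval T) => [t||] //.
have -> : - (t^-1)%:C%C *: (invmx P *m diag_mx v^%:C *m P) =
    invmx P *m diag_mx (- t^-1 *: v)^%:C *m P.
  by rewrite scale_conjmx -linearZ /= map_mxZ rmorphN.
set w := _ *: v.
rewrite expmx_diagonalizable //.
rewrite mxtrace_mulC mulmxA mulmxV // mul1mx mxtrace_diag scale_conjmx.
(* The partition function, positive because [0 < m] provides at least one level. *)
pose s : R := \sum_i expR (w 0 i).
have s0 : 0 < s.
  rewrite /s (bigD1 (Ordinal m0)) //= ltr_wpDr ?expR_gt0 //.
  by apply: sumr_ge0 => i _; apply: expR_ge0.
exists (\row_i (s^-1 * expR (w 0 i))) => [i|].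
  by rewrite mxE mulr_gt0 ?invr_gt0 ?expR_gt0.
congr (_ *m _ *m _).
apply/matrixP => i j; rewrite !mxE mulrnAr rmorphM fmorphV rmorph_sum /=.
congr (_^-1 * _ *+ _).
by apply: eq_bigr => k _; rewrite !mxE.
Qed.

Lemma gibbs_diag m (v : 'rV[R]_m) (T : temperature R) : (0 < m)%N ->
  exists2 p : 'rV[R]_m, (forall i, 0 < p 0 i)
    & gibbs (diag_mx v^%:C) T = diag_mx p^%:C.
Proof.
move=> m0; have [p p0 pE] := gibbs_conj_diag v T m0 (unitmx1 _ _).
by exists p => //; rewrite !invmx1 !mulmx1 !mul1mx in pE.
Qed.

Lemma gibbs_comm m (K : 'M[C]_m) (T : temperature R) : (0 < m)%N ->
  K \is hermsymmx -> K *m gibbs K T = gibbs K T *m K.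
Proof.
move=> m0 /hermitian_spectral[P [v [/unitarymx_unit uP ->]]].
have [p _ ->] := gibbs_conj_diag v T m0 uP.
exact: conj_diag_comm.
Qed.

End Gibbs.

(** * Bohr spectrum *)

Section Adjoint.
Context {R : realType}.
Local Notation C := (Cplx R).
Local Notation "v ^%:C" := (map_mx toC v) (at level 8).

Lemma ad_fun_conj n (W D Y : 'M[C]_n) : W \is unitarymx ->
  ad_fun (W *m D *m W^t*) (W *m Y *m W^t*) = W *m ad_fun D Y *m W^t*.
Proof.
move=> uW; have WW := unitary_ctmxK uW.
rewrite /ad_fun mulmxBr mulmxBl !mulmxA -!(mulmxA _ (W^t*) W) WW !mulmx1.
by [].
Qed.

Lemma ad_fun_diagE n (v : 'rV[R]_n) (Y : 'M[C]_n) i j :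
  ad_fun (diag_mx v^%:C) Y i j = toC (v 0 i - v 0 j) * Y i j.
Proof.
rewrite /ad_fun mxE mul_diag_mx mxE mxE mul_mx_diag !mxE rmorphB mulrBl.
by rewrite (mulrC (Y i j)).
Qed.

Lemma ad_fun_diag_delta n (v : 'rV[R]_n) i j :
  ad_fun (diag_mx v^%:C) (delta_mx i j) = toC (v 0 i - v 0 j) *: delta_mx i j.
Proof.
apply/matrixP => k l; rewrite ad_fun_diagE !mxE.
by case: eqP => [->|_]; case: eqP => [->|_]; rewrite /= ?mulr0.
Qed.

(** Rotated matrix units are eigenvectors for the differences; conversely, any nonzero entry of an
    eigenvector, read in the eigenbasis, determines its eigenvalue. *)
Lemma bohr_spectrumE n (W : 'M[C]_n) (v : 'rV[R]_n) : W \is unitarymx ->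
  bohr_spectrum (W *m diag_mx v^%:C *m W^t*) =
  [set toC (v 0 p.1 - v 0 p.2) | p in [set: 'I_n * 'I_n]].
Proof.
move=> uW; set H := W *m _ *m _; apply/seteqP; split => [a|_ [[i j] _ <-]].
  (* [vpick] supplies a nonzero eigenvector of the nontrivial eigenspace. *)
  rewrite /bohr_spectrum /= /passmx.leigenvalue -vpick0.
  set X := vpick _ => X0.
  have : X \in passmx.leigenspace (linfun (ad_fun H)) a by apply: memv_pick.
  rewrite /passmx.leigenspace memv_ker add_lfunE opp_lfunE scale_lfunE
    id_lfunE lfunE /= subr_eq0 => /eqP.
  rewrite -(unitary_conjK X uW); set Y := W^t* *m X *m W.
  rewrite ad_fun_conj // => HY.
  have adY : ad_fun (diag_mx v^%:C) Y = a *: Y.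
    rewrite -[LHS](unitary_conjVK _ uW) HY -scalemxAr -scalemxAl.
    by rewrite unitary_conjVK.
  have /matrix0Pn[i [j Yij]] : Y != 0.
    by apply: contraNneq X0 => Y0; rewrite -(unitary_conjK X uW) -/Y Y0 mulmx0 mul0mx.
  exists (i, j) => //=; apply: (mulIf Yij).
  by rewrite -ad_fun_diagE adY mxE.
rewrite /bohr_spectrum /= /passmx.leigenvalue.
set E := passmx.leigenspace _ _.
have XE : W *m delta_mx i j *m W^t* \in E.
  rewrite /passmx.leigenspace memv_ker add_lfunE opp_lfunE scale_lfunE
    id_lfunE lfunE /= subr_eq0.
  by rewrite ad_fun_conj // ad_fun_diag_delta -scalemxAr -scalemxAl.
apply/negP => /eqP E0; move: XE; rewrite E0 memv0 => /eqP X0.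
have := unitary_conjVK (delta_mx i j) uW.
rewrite X0 mulmx0 mul0mx => /matrixP/(_ i j)/eqP.
by rewrite !mxE !eqxx eq_sym oner_eq0.
Qed.

(** By contraposition and counting: without such a quadruple the differences over the [n ^ 2 - n]
    off-diagonal pairs are distinct and nonzero, and together with 0 they exceed the bound in
    [degenerate_bohr]. *)
Lemma degenerate_bohrP n (W : 'M[C]_n) (v : 'rV[R]_n) : W \is unitarymx ->
  (0 < n)%N -> degenerate_bohr (W *m diag_mx v^%:C *m W^t*) ->
  exists i j k l, [/\ i != j, k != l, i != k & v 0 i - v 0 j = v 0 k - v 0 l].
Proof.
move=> uW n0; rewrite /degenerate_bohr bohr_spectrumE // => card_lt.
apply: contrapT => noquad.
have dif i j k l : i != j -> k != l -> v 0 i - v 0 j = v 0 k - v 0 l -> i = k.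
  move=> ij kl e; apply: contrapT => ik; apply: noquad.
  by exists i, j, k, l; split => //; apply/eqP.
(* A repeated eigenvalue would itself give the forbidden quadruple [i, j, j, i], both differences
   being 0. *)
have vinj i j : v 0 i = v 0 j -> i = j.
  move=> e; apply: contrapT => /eqP ij.
  have ji : j != i by rewrite eq_sym.
  have ijE : i = j by apply: (dif _ _ _ _ ij ji); rewrite e.
  by rewrite ijE eqxx in ij.
pose f (p : 'I_n * 'I_n) : C := toC (v 0 p.1 - v 0 p.2).
pose D := [set (i, i) | i : 'I_n]%SET.
have inD p : (p \in D) = (p.1 == p.2).
  apply/imsetP/eqP => [[i _ ->]//|]; case: p => i j /= ->.
  by exists j.
have cardD : #|~: D| = (n ^ 2 - n)%N.
  rewrite cardsCs finset.setCK card_prod !card_ord card_imset ?card_ord // => i j [].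
  by [].
have fin : finite_set [set f p | p in [set: 'I_n * 'I_n]].
  exact/finite_image/finite_finset.
pose s := 0 :: [seq f p | p in ~: D].
move: card_lt; rewrite ltnNge => /negP; apply.
have -> : (n ^ 2 - n + 1)%N = size s by rewrite /= size_image cardD addn1.
apply: uniq_leq_size.
  rewrite /= map_inj_in_uniq ?enum_uniq ?andbT.
    apply/fintype.imageP => -[[i j]]; rewrite inE inD /= => ij.
    rewrite /f -(rmorph0 toC) => /fmorph_inj/esym/eqP.
    rewrite subr_eq0 => /eqP/vinj.
    by apply/eqP.
  move=> [i j] [k l]; rewrite !mem_enum !inE !inD /= => ij kl.
  move=> /fmorph_inj /= e.
  (* Equal differences force equal first indices; cancelling them and using [vinj] gives equal
     second indices. *)
  have ik := dif _ _ _ _ ij kl e; rewrite ik in e *; congr (_, _).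
  by apply: vinj; move: e => /addrI/oppr_inj.
move=> a; rewrite inE => /orP[/eqP->|/fintype.imageP[p _ ->]].
  rewrite in_fset_set // inE /=; exists (Ordinal n0, Ordinal n0) => //=.
  by rewrite subrr.
by rewrite in_fset_set // inE /=; exists p.
Qed.

(** By covariance the image of the rotated matrix unit satisfies the eigenvector equation of
    [ad_fun] for [v 0 i - v 0 j], so its entries at positions with another difference vanish. *)
Lemma TO_coef_eq0 n (W : 'M[C]_n) (v : 'rV[R]_n) (T : temperature R) S i j k l :
  W \is unitarymx -> TO (W *m diag_mx v^%:C *m W^t*) T S ->
  v 0 i - v 0 j != v 0 k - v 0 l ->
  (W^t* *m S (W *m delta_mx i j *m W^t*) *m W) k l = 0.
Proof.
move=> uW [m [K [U [m0 hK uU HU ->]]]] ne.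
have := thermal_fun_covariant (W *m delta_mx i j *m W^t*) (gibbs_comm T m0 hK) uU HU.
rewrite lfunE /= ad_fun_conj // ad_fun_diag_delta -scalemxAr -scalemxAl.
rewrite linearZ /=.
set Z := thermal_fun _ _ _ _; rewrite -{2}(unitary_conjK Z uW).
rewrite ad_fun_conj //; set Y := W^t* *m Z *m W => e.
have : toC (v 0 i - v 0 j) *: Y = ad_fun (diag_mx v^%:C) Y.
  by rewrite -[RHS](unitary_conjVK _ uW) -e -scalemxAr -scalemxAl.
move=> /matrixP/(_ k l)/eqP; rewrite ad_fun_diagE mxE -subr_eq0 -mulrBl mulf_eq0.
case/orP => [|/eqP //].
by rewrite -rmorphB fmorph_eq0 subr_eq0 (negPf ne).
Qed.

End Adjoint.

(** * Coupling of coherences *)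

Section Swap.
Context {R : realType}.
Local Notation C := (Cplx R).
Local Notation "v ^%:C" := (map_mx toC v) (at level 8).

Lemma diag_hermitian m (v : 'rV[R]_m) : (diag_mx v^%:C : 'M[C]_m) \is hermsymmx.
Proof.
apply/is_hermitianmxP; rewrite scale1r; apply/matrixP => i j.
rewrite !mxE rmorphMn /= conj_Creal ?real_toC // eq_sym.
by case: eqP => [->|].
Qed.

Lemma conj_diag_hermitian m (W : 'M[C]_m) (v : 'rV[R]_m) :
  W *m diag_mx v^%:C *m W^t* \is hermsymmx.
Proof.
apply/is_hermitianmxP; rewrite scale1r !mul_ctmx trmxCK -mulmxA.
by have /is_hermitianmxP := diag_hermitian v; rewrite scale1r => <-.
Qed.

Lemma total_hamiltonian_diagE n m (v : 'rV[R]_n) (h : 'rV[R]_m) i a j b :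
  total_hamiltonian (diag_mx v^%:C) (diag_mx h^%:C)
    (mxtens_index (i, a)) (mxtens_index (j, b)) =
  toC (v 0 i + h 0 a) *+ (mxtens_index (i, a) == mxtens_index (j, b)).
Proof.
rewrite /total_hamiltonian mxE !tensmxE !mxE (can_eq (@mxtens_indexK _ _)).
rewrite xpair_eqE rmorphD.
by case: eqP => _; case: eqP => _; rewrite /= ?mulr0 ?mul0r ?mulr1 ?mul1r ?addr0.
Qed.

Lemma exists_TO_coupling n (W : 'M[C]_n) (v : 'rV[R]_n) (T : temperature R)
    i j k l :
  W \is unitarymx -> i != j -> k != l -> v 0 i - v 0 j = v 0 k - v 0 l ->
  exists2 S, TO (W *m diag_mx v^%:C *m W^t*) T S &
    0 < (W^t* *m S (W *m delta_mx i j *m W^t*) *m W) k l.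
Proof.
move=> uW ij kl e.
(* The gap makes the level [i] with bath index 0 resonant with the level [k] with bath index 1; by
   [e] the same gap serves [j] and [l]. *)
pose h : 'rV[R]_2 := \row_a (if a == ord0 then 0 else v 0 i - v 0 k).
pose D := diag_mx v^%:C; pose K : 'M[C]_2 := diag_mx h^%:C.
pose ix x (a : 'I_2) : 'I_(n * 2) := mxtens_index (x, a).
have ixE x a y b : (ix x a == ix y b) = (x == y) && (a == b).
  by rewrite /ix (can_eq (@mxtens_indexK _ _)).
pose f (x : 'I_(n * 2)) : R :=
  v 0 (mxtens_unindex x).1 + h 0 (mxtens_unindex x).2.
have fE x a : f (ix x a) = v 0 x + h 0 a by rewrite /f mxtens_indexK.
pose s : 'S_(n * 2) := (tperm (ix i ord0) (ix k ord_max) *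
                        tperm (ix j ord0) (ix l ord_max))%g.
(* Each transposition exchanges two indices of equal total energy [f]. *)
have fs x : f (s x) = f x.
  rewrite permM; have ft a b y : f a = f b -> f (tperm a b y) = f y.
    by move=> fab; case: tpermP => [->|->|].
  by rewrite !ft // !fE !mxE /=; move: e; clear; lra.
(* The hypotheses [ij] and [kl] keep the two transpositions from interfering at the relevant
   indices. *)
have sk : s (ix k ord_max) = ix i ord0.
  by rewrite permM tpermR tpermD // ixE ?andbF // negb_and eq_sym ij.
have sl : s (ix l ord_max) = ix j ord0.
  by rewrite permM (@tpermD _ (ix i _)) ?tpermR // ixE ?andbF // negb_and kl.
(* The permutation acts in the eigenbasis of the system; conjugation by [W *t 1%:M] carries it to
   the original basis. *)
pose U := (W *t 1%:M) *m perm_mx s *m (W *t 1%:M)^t* : 'M[C]_(n * 2).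
have u1 : (1%:M : 'M[C]_2) \is unitarymx.
  by apply/unitarymxP; rewrite trmx1 map_mx1 mulmx1.
have uW1 : W *t (1%:M : 'M[C]_2) \is unitarymx by apply: tens_unitary.
have uU : U \is unitarymx.
  exact: (unitary_conj_unitary uW1 (perm_mx_unitary _ s)).
have UE (Y : 'M[C]_(n * 2)) :
    U *m ((W *t 1%:M) *m Y *m (W *t 1%:M)^t*) *m U^t* =
    (W *t 1%:M) *m (perm_mx s *m Y *m (perm_mx s)^t*) *m (W *t 1%:M)^t*.
  exact: (@unitary_conj_conj C _ (W *t 1%:M) (perm_mx s) Y uW1).
have cE : (W *t (1%:M : 'M[C]_2))^t* = W^t* *t 1%:M.
  by rewrite tens_ctmx trmx1 map_mx1.
have tE (A : 'M[C]_n) (B : 'M[C]_2) :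
    (W *m A *m W^t*) *t B = (W *t 1%:M) *m (A *t B) *m (W *t 1%:M)^t*.
  by rewrite cE !tensmx_mul mul1mx mulmx1.
have HE : total_hamiltonian (W *m D *m W^t*) K =
    (W *t 1%:M) *m total_hamiltonian D K *m (W *t 1%:M)^t*.
  rewrite /total_hamiltonian tE mulmxDr mulmxDl; congr (_ + _).
  by rewrite -tE mulmx1 (unitarymxP uW).
have UH : U *m total_hamiltonian (W *m D *m W^t*) K *m U^t* =
    total_hamiltonian (W *m D *m W^t*) K.
  rewrite HE UE; congr (_ *m _ *m _); apply/matrixP => x y.
  rewrite perm_mx_conjE.
  have tot x' y' : total_hamiltonian D K x' y' = toC (f x') *+ (x' == y').
    case: (mxtens_indexP x') => x1 a1; case: (mxtens_indexP y') => y1 b1.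
    by rewrite total_hamiltonian_diagE -fE.
  by rewrite !tot fs (inj_eq perm_inj).
exists (thermal_map T K U).
  by exists 2%N, K, U; split => //; apply: diag_hermitian.
have [p p0 gE] := @gibbs_diag R 2 h T isT.
rewrite lfunE /= /thermal_fun tE UE cE ptrace_mulr ptrace_mull unitary_conjVK //.
rewrite mxE; under eq_bigr do rewrite perm_mx_conjE.
(* The summand with bath index 1 is pulled back by [s] to the ground-state population [p 0 ord0],
   which is positive. *)
rewrite (bigD1 ord_max) //= -/(ix k ord_max) -/(ix l ord_max) sk sl.
rewrite tensmxE mxE !eqxx mul1r gE !mxE eqxx mulr1n ltr_wpDr //; last first.
  by rewrite -(rmorph0 toC) lt_toC.
(* The other summands are entries of a matrix unit tensored with a nonnegative diagonal matrix, so
   they cannot cancel the positive one. *)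
apply: sumr_ge0 => a _.
case: (mxtens_indexP (s _)) => x1 a1; case: (mxtens_indexP (s _)) => y1 b1.
rewrite tensmxE !mxE mulr_ge0 ?ler0n //.
by case: eqP => // _; rewrite mulr1n -(rmorph0 toC) le_toC ltW.
Qed.

End Swap.

(** * Discontinuity *)

Section Discontinuity.
Context {R : realType}.
Local Notation C := (Cplx R).
Local Notation "v ^%:C" := (map_mx toC v) (at level 8).

Lemma continuous_conj_diag n (W : 'M[C]_n) (v d : 'rV[R]_n) :
  continuous (fun e : R => W *m diag_mx (v + e *: d)^%:C *m W^t*).
Proof.
move=> e; apply: mx_cvg => i j.
under eq_fun do rewrite mxE.
rewrite mxE; apply: cvg_sumr => k _; apply: cvgM; last exact: cvg_cst.
under eq_fun do rewrite mxE.
rewrite mxE; apply: cvg_sumr => l _; apply: cvgM; first exact: cvg_cst.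
under eq_fun do rewrite !mxE.
rewrite !mxE; apply: cvgMn.
have c : v 0 l + e' * d 0 l @[e' --> e] --> v 0 l + e * d 0 l.
  by apply: cvgD; [exact: cvg_cst|apply: cvgM; [exact: cvg_id|exact: cvg_cst]].
exact: (cvg_comp _ _ c (@continuous_toC _ _)).
Qed.

(** Only the half of the maximum that ranges over [B] is used. A strict bound on the infimum yields
    a witness even if the infimum is not attained. *)
Lemma hausdorff11_lt n (A B : set 'End('M[C]_n)) (S : 'End('M[C]_n)) (e : R) :
  (hausdorff11 A B < e%:E)%E -> B S -> exists2 S', A S' & opnorm11 (S' - S) < e.
Proof.
rewrite /hausdorff11 gt_max => /andP[_ ltB] BS.
have lti : (ereal_inf [set (opnorm11 (S1 - S))%:E | S1 in A] < e%:E)%E.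
  by apply: le_lt_trans ltB; apply: ereal_sup_ubound; exists S.
have [_ [S' AS' <-] lt'] := ereal_inf_lt lti.
by exists S'.
Qed.

Lemma trnorm0 n : trnorm (0 : 'M[C]_n) = 0.
Proof.
apply/eqP; rewrite eq_le trnorm_ge0 andbT -le_toC.
apply: le_trans (trnorm_le_frob _) _.
have -> : frobsq (0 : 'M[C]_n) = 0.
  by rewrite frobsqE mulmx0 mxtrace0.
by rewrite sqrtC0 mulr0 rmorph0.
Qed.

Lemma opnorm11_0 n : opnorm11 (0 : 'End('M[C]_n)) = 0.
Proof.
rewrite /opnorm11 (_ : [set _ | _ in _] = [set 0]) ?sup1 //.
apply/seteqP; split => [_ [X _ <-]|_ ->]; first by rewrite lfunE /= trnorm0.
by exists 0; rewrite /= ?lfunE /= trnorm0 // ler01.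
Qed.

Lemma sub_closure11 n (A : set 'End('M[C]_n)) : A `<=` closure11 A.
Proof. by move=> S AS e e0; exists S => //; rewrite subrr opnorm11_0. Qed.

End Discontinuity.

Theorem mainTheorem3 (R : realType) (n : nat) (hn : (0 < n)%N)
    (HS : hermitian_space R n) (hHS : degenerate_bohr (sval HS))
    (T : temperature R) :
  ~ (hausdorff11 (TO_closure HT) (TO_closure (HS, T))
       @[HT --> (HS, T)] --> 0%E).
Proof.
move=> cvgH.
have [P [v [uP HE]]] := hermitian_spectral (svalP HS).
pose W := P^t*; have uW : W \is unitarymx by rewrite trmxC_unitary.
have {}HE : sval HS = W *m diag_mx (map_mx toC v) *m W^t*.
  by rewrite HE (invmx_unitary uP) trmxCK.
rewrite HE in hHS.
have [i [j [k [l [ij kl ik e]]]]] := degenerate_bohrP uW hn hHS.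
have [S TOS q0] := exists_TO_coupling T uW ij kl e.
rewrite -HE in TOS.
pose c (S : 'End('M[Cplx R]_n)) := (W^t* *m S (W *m delta_mx i j *m W^t*) *m W) k l.
have cB S1 S2 : c (S1 - S2) = c S1 - c S2.
  by rewrite /c add_lfunE opp_lfunE mulmxBr mulmxBl !mxE.
pose q := complex.Re (c S).
have qE : c S = toC q by rewrite /q toC_Re // gtr0_real.
have {}q0 : 0 < q by rewrite -lt_toC rmorph0 -qE.
pose d : 'rV[R]_n := delta_mx 0 i.
pose path (x : R) : hermitian_space R n :=
  exist (fun H => is_true (H \is hermsymmx)) _ (conj_diag_hermitian W (v + x *: d)).
have path0 : path 0 = HS.
  case: HS HE {hHS TOS cvgH} => H hH /= HE; apply: eq_exist.
  by rewrite HE scale0r addr0.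
have cpath : continuous path.
  by apply: continuous_comp_initial; exact: continuous_conj_diag.
(* The punctured filter excludes [x = 0], where the perturbation would not split the two
   differences. *)
have cvgp : hausdorff11 (TO_closure (path x, T)) (TO_closure (HS, T))
    @[x --> 0^'] --> 0%E.
  have c1 : (path x, T) @[x --> 0^'] --> (HS, T).
    have c0 : path x @[x --> 0^'] --> HS.
      by rewrite -path0; apply: cvg_within_filter; exact: cpath.
    exact: (cvg_pair c0 (cvg_cst T)).
  exact: (cvg_comp _ _ c1 cvgH).
(* Two approximations within [eps] each move the coefficient by at most [n%:R * eps], that is
   [q / 4], which leaves a contradiction with the jump [q]. *)
pose eps := q / (4 * n%:R).
have n0 : 0 < n%:R :> R by rewrite ltr0n.
have eps0 : 0 < eps by rewrite divr_gt0 // mulr_gt0.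
have near_lt : \forall x \near 0^',
    (hausdorff11 (TO_closure (path x, T)) (TO_closure (HS, T)) < eps%:E)%E.
  apply: (cvgp [set y | (y < eps%:E)%E]); apply: open_nbhs_nbhs; split.
    exact: open_ereal_lt_ereal.
  by rewrite /= lte_fin.
have near_ne : \forall x \near (0 : R)^', x != 0 by exact: nbhs_dnbhs_neq.
have [x [xlt xne]] := @filter_ex _ _ (Proper_dnbhs_numFieldType _) _
  (filterI near_lt near_ne).
(* The Hausdorff bound only reaches the closure; a second approximation reaches a genuine thermal
   operation [S2]. *)
have [S1 clS1 lt1] := hausdorff11_lt xlt (sub_closure11 TOS).
have [S2 TOS2 lt2] := clS1 _ eps0.
have c2 : c S2 = 0.
  apply: (TO_coef_eq0 uW TOS2).
  have dE a : (v + x *: d) 0 a = v 0 a + x * (a == i)%:R by rewrite !mxE eqxx.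
  rewrite !dE eqxx (eq_sym j) (negPf ij) (eq_sym k) (negPf ik).
  (* The first difference grows by [x], while the second changes by 0, or by [- x] if [l = i];
     equality would force [x = 0] in both cases. *)
  apply: contra_neq xne; case: eqP => _ /=; move: e; clear; lra.
have le1 S' S'' : opnorm11 (S' - S'') < eps -> `|c S' - c S''| <= toC (q / 4).
  move=> lt; rewrite -cB; apply: le_trans (coef_le_opnorm11 _ _ _ _ _ uW) _.
  have -> : q / 4 = n%:R * eps by rewrite /eps; field; rewrite ?lt0r_neq0.
  change (toC (n%:R * opnorm11 (S' - S'')) <= toC (n%:R * eps)).
  rewrite le_toC.
  exact: (ler_wpM2l (ltW n0) (ltW lt)).
have : `|toC q| <= toC (q / 4) + toC (q / 4).
  have -> : toC q = (c S1 - c S2) - (c S1 - c S).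
    by rewrite opprB addrC addrA subrK c2 subr0 qE.
  exact: (le_trans (ler_normB _ _) (lerD (le1 _ _ lt2) (le1 _ _ lt1))).
rewrite norm_toC gtr0_norm // -rmorphD le_toC.
by move: q0; clear; lra.
Qed.
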